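(* Let $L = L_{\mathbb{F}}(R)$ be the Chevalley Lie algebra over $\mathbb{F} = \mathrm{GF}(2)$ of the simply connected root datum $R$ of type $\mathrm{C}_4$, with Chevalley basis $\{X_\alpha, h_i \mid \alpha \in \Phi,\ i \in \{1,2,3,4\}\}$, where $h_i = \alpha_i^\vee \otimes 1$. The simple roots are $\alpha_1,\alpha_2,\alpha_3$ (short) and $\alpha_4$ (long), in the usual order along the Dynkin diagram. Write $(c_1,c_2,c_3,c_4)$ for $c_1\alpha_1+c_2\alpha_2+c_3\alpha_3+c_4\alpha_4$, and put $\alpha_8 = (1,1,1,0)$, $\alpha_9=(0,1,1,1)$, $\alpha_{12} = (0,1,2,1)$, $\alpha_{15} = (1,2,2,1)$. Let $$y_1 = h_1 + h_3,\qquad y_2 = h_1 + X_{\alpha_{12}} + X_{-\alpha_8},\qquad y_3 = h_2 + X_{\alpha_3} + X_{-\alpha_3} + X_{\alpha_{15}} + X_{-\alpha_{15}},$$ and let $H = \langle y_1, y_2, y_3\rangle_L$ be the subalgebra of $L$ generated by $y_1,y_2,y_3$. Then $H$ is a $3$-dimensional split toral subalgebra of $L$, but there does not exist a split toral subalgebra $H'$ of $L$ of dimension $4$ such that $H \subseteq H'$.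
   Context: Root datum and Chevalley Lie algebra. A root datum $R = (X,\Phi,Y,\Phi^\vee)$ of rank $n$ consists of free $\mathbb{Z}$-modules $X,Y$ of rank $n$ in duality via a pairing $\langle\cdot,\cdot\rangle: X\times Y\to\mathbb{Z}$, and finite sets of roots $\Phi\subset X$ and coroots $\Phi^\vee\subset Y$, both forming root systems, with a bijection $\alpha\mapsto\alpha^\vee$ such that $\langle\alpha,\alpha^\vee\rangle=2$. It is simply connected if $X/\mathbb{Z}\Phi$ is the full fundamental group, i.e. $X$ is the weight lattice and $Y=\mathbb{Z}\Phi^\vee$, so that the simple coroots form a basis of $Y$. Define $L_{\mathbb{Z}}(R) = Y\oplus\bigoplus_{\alpha\in\Phi}\mathbb{Z}X_\alpha$ with the alternating bilinear bracket given by: - $[y,z]=0$ for $y,z\in Y$; - $[X_\alpha,y]=\langle\alpha,y\rangle X_\alpha$ for $y \in Y$, $\alpha\in\Phi$; - $[X_{-\alpha},X_\alpha]=\alpha^\vee$ for $\alpha\in\Phi$; - for $\alpha\ne\pm\beta$ in $\Phi$, $[X_\alpha,X_\beta]=N_{\alpha,\beta}X_{\alpha+\beta}$ if $\alpha+\beta\in\Phi$ and $0$ otherwise. Here $N_{\alpha,\beta}=\pm(p_{\alpha,\beta}+1)$, where $p_{\alpha,\beta}$ is the largest integer such that $\alpha-p_{\alpha,\beta}\beta$ is a root, with signs chosen so that the Jacobi identity holds (over $\mathrm{GF}(2)$ the signs are irrelevant). Then $L_{\mathbb{F}}(R)=L_{\mathbb{Z}}(R)\otimes\mathbb{F}$.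 Toral subalgebras. $L$ is a restricted Lie algebra with the $p$-map ($p=\operatorname{char}\mathbb{F}$) $x\mapsto x^p$ coming from the Lie algebra of the corresponding algebraic group; it satisfies $X_\alpha^p=0$ and $(\alpha^\vee\otimes 1)^p=\alpha^\vee\otimes 1$. An element $x\in L$ is semisimple if it lies in the $p$-subalgebra generated by $x^p$. A toral subalgebra of $L$ is a commutative subalgebra consisting of semisimple elements. It is split if for every element $h$ of it, $\operatorname{ad}_h$ (on $L$) is diagonalizable over $\mathbb{F}$. *)

(* Defs.v *)
From HB Require Import structures.
From mathcomp Require Import all_boot all_order all_algebra.
From mathcomp Require Import finmap.
From mathcomp Require Import zify ring.

Set Implicit Arguments.
Unset Strict Implicit.
Unset Printing Implicit Defensive.

Import Order.TTheory GRing.Theory Num.Theory.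
Local Open Scope ring_scope.

Definition pairing (n : nat) (x y : 'rV[int]_n) : int := \sum_i x 0 i * y 0 i.

(* X and Y are both Z^n, written in a pair of dual bases, so that the perfect
   duality is the dot product.  [rd_coroot] only matters on [rd_roots]. *)
Record root_datum (n : nat) := RootDatum {
  rd_roots : {fset 'rV[int]_n};
  rd_coroot : 'rV[int]_n -> 'rV[int]_n;
  _ : {in rd_roots &, injective rd_coroot};
  _ : {in rd_roots, forall a, pairing a (rd_coroot a) = 2};
  _ : {in rd_roots &, forall a b, b - pairing b (rd_coroot a) *: a \in rd_roots};
  _ : {in rd_roots &, forall a b, exists2 c, c \in rd_roots &
        rd_coroot b - pairing a (rd_coroot b) *: rd_coroot a = rd_coroot c};
  _ : {in rd_roots, forall a, 2 *: a \notin rd_roots}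
}.

(* Y = Z Phi^vee *)
Definition simply_connected (n : nat) (R : root_datum n) : Prop :=
  forall y : 'rV[int]_n, exists c : 'rV[int]_n -> int,
    y = \sum_(a <- rd_roots R) c a *: rd_coroot R a.

(* (Y (x) F) + sum_alpha F X_alpha, the second component being the family of
   coefficients of the X_alpha *)
Notation chevalley F n R :=
  ('rV[F]_n * {ffun rd_roots R -> GRing.regular F})%type (only parsing).

Section Chevalley.
Variables (F : comNzRingType) (n : nat) (R : root_datum n).
Local Notation L := ('rV[F]_n * {ffun rd_roots R -> F^o})%type.

Definition Xroot (a : 'rV[int]_n) : L := (0, [ffun b => (val b == a)%:R]).

Definition Ytensor (y : 'rV[int]_n) : L := (map_mx intr y, 0).

Definition pairingF (a : 'rV[int]_n) (y : 'rV[F]_n) : F :=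
  \sum_i (a 0 i)%:~R * y 0 i.

Variable N : 'rV[int]_n -> 'rV[int]_n -> int.

(* [Xroot (a + b)] vanishes when a + b is not a root, in particular when
   b = a. *)
Definition root_bracket (a b : 'rV[int]_n) : L :=
  if a == - b then Ytensor (rd_coroot R b) else (N a b)%:~R *: Xroot (a + b).

Definition chevalley_bracket (u v : L) : L :=
  \sum_(a : rd_roots R)
     (u.2 a * pairingF (val a) v.1 - v.2 a * pairingF (val a) u.1)
       *: Xroot (val a)
  + \sum_(a : rd_roots R) \sum_(b : rd_roots R)
     (u.2 a * v.2 b) *: root_bracket (val a) (val b).

End Chevalley.

Definition lie_axioms (V : zmodType) (br : V -> V -> V) : Prop :=
  (forall x, br x x = 0) /\
  (forall x y z, br x (br y z) + br y (br z x) + br z (br x y) = 0).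

(* N a b = +-(p_(a,b) + 1), with signs for which L_Z(R), the case F = int of
   the construction above, is a Lie algebra.  The values of N at pairs whose
   sum is not a root play no role. *)
Definition chevalley_constants (n : nat) (R : root_datum n)
    (N : 'rV[int]_n -> 'rV[int]_n -> int) : Prop :=
  {in rd_roots R &, forall a b, a != b -> a != - b -> a + b \in rd_roots R ->
     exists p : int,
       [/\ a - p *: b \in rd_roots R,
           forall q : int, a - q *: b \in rd_roots R -> q <= p &
           N a b = p + 1 \/ N a b = - (p + 1)]}
  /\ lie_axioms (@chevalley_bracket int n R N).

Section Restricted.
Variables (F : fieldType) (V : vectType F) (br : V -> V -> V) (pm : V -> V).

Definition subalgebra (U : {vspace V}) : Prop :=
  {in U &, forall x y, br x y \in U}.

Definition generated_subalgebra (S : seq V) (H : {vspace V}) : Prop :=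
  [/\ subalgebra H, {subset S <= H} &
      forall U : {vspace V}, subalgebra U -> {subset S <= U} -> (H <= U)%VS].

(* The axioms of a p-map for p = 2: Jacobson's formula for (x + y)^[p] has
   the single correction term [x, y]. *)
Definition two_map : Prop :=
  [/\ forall x z, br (pm x) z = br x (br x z),
      forall (a : F) x, pm (a *: x) = a ^+ 2 *: pm x &
      forall x y, pm (x + y) = pm x + pm y + br x y].

Definition psubalgebra (U : {vspace V}) : Prop :=
  subalgebra U /\ {in U, forall x, pm x \in U}.

(* x lies in the smallest p-subalgebra containing x^[p]. *)
Definition semisimple (x : V) : Prop :=
  forall U : {vspace V}, psubalgebra U -> pm x \in U -> x \in U.

Definition toral (H : {vspace V}) : Prop :=
  [/\ subalgebra H, {in H &, forall x y, br x y = 0} &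
      {in H, forall x, semisimple x}].

Definition diagonalizable_endo (f : V -> V) : Prop :=
  exists2 b : seq V, basis_of fullv b &
    {in b, forall v, exists a : F, f v = a *: v}.

Definition split_toral (H : {vspace V}) : Prop :=
  toral H /\ {in H, forall h, diagonalizable_endo (br h)}.

End Restricted.

Section TypeC.
Variable n : nat.
Local Notation X := 'rV[int]_n.

(* +- eps_i, the sign being - when the boolean is true *)
Definition seps (p : 'I_n * bool) : X := (-1) ^+ p.2 *: delta_mx 0 p.1.

(* +- eps_i +- eps_j (i <> j) and +- 2 eps_i *)
Definition C_roots : {fset X} :=
  [fset v : X in [seq (seps p + seps q)%R | p <- enum {: 'I_n * bool},
                                           q <- enum {: 'I_n * bool}]
     | v != 0%R]%fset.

(* 2 a / (a, a), an exact division on roots *)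
Definition C_coroot (a : X) : X := \row_i divz (2 * a 0 i) (pairing a a).

Lemma pairingC (x y : X) : pairing x y = pairing y x.
Proof. by apply: eq_bigr => i _; rewrite mulrC. Qed.

Lemma pairingDl (x x' y : X) : pairing (x + x') y = pairing x y + pairing x' y.
Proof. by rewrite -big_split; apply: eq_bigr => i _; rewrite mxE mulrDl. Qed.

Lemma pairingZl c (x y : X) : pairing (c *: x) y = c * pairing x y.
Proof. by rewrite mulr_sumr; apply: eq_bigr => i _; rewrite mxE mulrA. Qed.

Lemma pairingNl (x y : X) : pairing (- x) y = - pairing x y.
Proof. by rewrite -scaleN1r pairingZl mulN1r. Qed.

Lemma pairingDr (x y y' : X) : pairing x (y + y') = pairing x y + pairing x y'.
Proof. by rewrite pairingC pairingDl !(pairingC x). Qed.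

Lemma pairingZr c (x y : X) : pairing x (c *: y) = c * pairing x y.
Proof. by rewrite pairingC pairingZl (pairingC x). Qed.

Lemma pairing_seps p q : pairing (seps p) (seps q) =
  if p.1 == q.1 then (-1) ^+ p.2 * (-1) ^+ q.2 else 0.
Proof.
rewrite pairingZl pairingZr /pairing (bigD1 p.1) //= big1 => [|i /negPf ip].
  rewrite !mxE !eqxx addr0 mul1r /=; case: eqP => _; first by rewrite mulr1.
  by rewrite !mulr0.
by rewrite !mxE ip mul0r.
Qed.

Lemma seps2 p : pairing (seps p) (seps p) = 1.
Proof. by rewrite pairing_seps eqxx -expr2 sqrr_sign. Qed.

Lemma seps_opp p : - seps p = seps (p.1, ~~ p.2).
Proof. by rewrite /seps signrN scaleNr. Qed.

Lemma seps_same p q : p.1 = q.1 -> seps p = seps q \/ seps p = - seps q.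
Proof.
by move=> e; rewrite seps_opp /seps e; case: (p.2) (q.2) => [] []; [left|right|right|left].
Qed.

Lemma C_rootsP v : reflect (v != 0 /\ exists p q, v = seps p + seps q)
                           (v \in C_roots).
Proof.
rewrite !inE /=; apply: (iffP andP) => [[/allpairsP[[p q] [_ _ ->]] v0]|[v0 [p [q e]]]].
  by split=> //; exists p, q.
by split=> //; apply/allpairsP; exists (p, q); split; rewrite ?mem_enum.
Qed.

Lemma C_coroot_long p : C_coroot (2 *: seps p) = seps p.
Proof.
apply/rowP => i; rewrite !mxE pairingZl pairingZr seps2 mulrA mulr1.
by rewrite mulKz.
Qed.

Lemma C_coroot_short p q : p.1 != q.1 ->
  C_coroot (seps p + seps q) = seps p + seps q.
Proof.
move=> /negPf pq; apply/rowP => i; rewrite mxE.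
rewrite !pairingDl !pairingDr !seps2 !pairing_seps pq eq_sym pq addr0 add0r.
by rewrite (_ : 1 + 1 = 2 :> int) // mulKz.
Qed.

Lemma C_rootsE v : v \in C_roots ->
  (exists2 p, v = 2 *: seps p & C_coroot v = seps p) \/
  (exists p q, [/\ p.1 != q.1, v = seps p + seps q & C_coroot v = v]).
Proof.
case/C_rootsP=> v0 [p [q e]]; have [pq|pq] := eqVneq p.1 q.1; last first.
  by right; exists p, q; split=> //; rewrite e C_coroot_short.
left; exists p; last rewrite -[RHS]C_coroot_long; last congr C_coroot.
all: rewrite e scaler_nat mulr2n; congr (_ + _).
all: by case: (seps_same pq) => // e'; rewrite e e' addNr eqxx in v0.
Qed.

Lemma long_root p : 2 *: seps p \in C_roots.
Proof.
apply/C_rootsP; split; last by exists p, p; rewrite scaler_nat mulr2n.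
apply/eqP => /(congr1 (fun v => pairing v (seps p))).
by rewrite pairingZl seps2 /pairing big1 // => i _; rewrite mxE mul0r.
Qed.

Lemma C_pairing2 : {in C_roots, forall a, pairing a (C_coroot a) = 2}.
Proof.
move=> a /C_rootsE [[p -> ->]|[p [q [/negPf pq e ->]]]].
  by rewrite pairingZl seps2.
by rewrite e !pairingDl !pairingDr !seps2 !pairing_seps pq eq_sym pq.
Qed.

Definition C_refl (a x : X) : X := x - pairing x (C_coroot a) *: a.

Lemma C_reflD a x y : C_refl a (x + y) = C_refl a x + C_refl a y.
Proof. by rewrite /C_refl pairingDl scalerDl opprD addrACA. Qed.

Lemma C_reflZ a c x : C_refl a (c *: x) = c *: C_refl a x.
Proof. by rewrite /C_refl pairingZl -scalerA scalerBr. Qed.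

Lemma C_refl_seps a r : a \in C_roots -> exists r', C_refl a (seps r) = seps r'.
Proof.
rewrite /C_refl => /C_rootsE [[p -> ->]|[p [q [pq e ->]]]].
  have [rp|rp] := eqVneq r.1 p.1; last first.
    by exists r; rewrite pairing_seps (negPf rp) scale0r subr0.
  exists (r.1, ~~ r.2); rewrite -seps_opp.
  by case: (seps_same rp) => ->; rewrite ?pairingNl seps2;
    apply/rowP => i; rewrite !mxE; ring.
rewrite e pairingDr.
have [rp|rp] := eqVneq r.1 p.1.
  have pE : pairing (seps p) (seps q) = 0 by rewrite pairing_seps (negPf pq).
  case: (seps_same rp) => ->;
  [exists (q.1, ~~ q.2); rewrite -seps_opp | exists q];
  rewrite ?pairingNl ?seps2 ?pE; apply/rowP => i; rewrite !mxE; ring.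
have [rq|rq] := eqVneq r.1 q.1.
  have pE : pairing (seps q) (seps p) = 0.
    by rewrite pairing_seps eq_sym (negPf pq).
  case: (seps_same rq) => ->;
  [exists (p.1, ~~ p.2); rewrite -seps_opp | exists p];
  rewrite ?pairingNl ?seps2 ?pE; apply/rowP => i; rewrite !mxE; ring.
by exists r; rewrite !pairing_seps (negPf rp) (negPf rq) addr0 scale0r subr0.
Qed.

Lemma C_refl_root : {in C_roots &, forall a b, C_refl a b \in C_roots}.
Proof.
move=> a b aR /[dup] bR /C_rootsP[b0 [p [q e]]]; apply/C_rootsP; split.
  apply: contra_neq b0; rewrite /C_refl => /eqP; rewrite subr_eq0 => /eqP eb.
  have := congr1 (fun v => pairing v (C_coroot a)) eb.
  rewrite /= pairingZl C_pairing2 // => h.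
  by rewrite eb (_ : pairing b _ = 0) ?scale0r //; lia.
have [p' p'E] := C_refl_seps p aR; have [q' q'E] := C_refl_seps q aR.
by exists p', q'; rewrite e C_reflD p'E q'E.
Qed.

Lemma C_crefl a y : a \in C_roots ->
  y - pairing a y *: C_coroot a = C_refl a y.
Proof.
rewrite /C_refl => /C_rootsE [[p -> ->]|[p [q [pq e ->]]]].
  by rewrite pairingZl (pairingC y) scalerA mulrC.
by rewrite (pairingC y).
Qed.

Lemma C_refl_isom a x y : a \in C_roots ->
  pairing (C_refl a x) (C_refl a y) = pairing x y.
Proof.
move=> aR; rewrite -(C_crefl y aR) /C_refl.
rewrite -!scaleNr !(pairingDl, pairingDr, pairingZl, pairingZr) C_pairing2 //.
ring.
Qed.

Lemma C_refl_coroot : {in C_roots &, forall a b,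
  C_coroot (C_refl a b) = C_refl a (C_coroot b)}.
Proof.
move=> a b aR /C_rootsE [[p -> ->]|[p [q [pq e ->]]]].
  have [r rE] := C_refl_seps p aR.
  by rewrite C_reflZ rE C_coroot_long.
have [p' p'E] := C_refl_seps p aR; have [q' q'E] := C_refl_seps q aR.
rewrite e C_reflD p'E q'E C_coroot_short //.
apply/eqP => pq'; have := C_refl_isom (seps p) (seps q) aR.
rewrite p'E q'E !pairing_seps (negPf pq) pq' eqxx -signr_addb.
by move/eqP; rewrite signr_eq0.
Qed.

Lemma C_coroot_inj : {in C_roots &, injective C_coroot}.
Proof.
have short_long p q r : p.1 != q.1 -> seps r <> seps p + seps q.
  move=> /negPf pq /(congr1 (fun v => pairing v v)).
  by rewrite !pairingDl !pairingDr !seps2 !pairing_seps pq eq_sym pq.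
move=> a b /C_rootsE [[p -> ->]|[p [q [pq eq_a ->]]]]
           /C_rootsE [[r -> ->]|[r [s [rs eq_b ->]]]] //.
- by move=> ->.
- by rewrite eq_b => /short_long -/(_ rs).
- by rewrite eq_a => /esym /short_long -/(_ pq).
Qed.

Lemma C_reduced : {in C_roots, forall a, 2 *: a \notin C_roots}.
Proof.
have norm a : a \in C_roots -> pairing a a = 4 \/ pairing a a = 2.
  move=> /C_rootsE [[p -> _]|[p [q [/negPf pq -> _]]]].
    by left; rewrite pairingZl pairingZr seps2.
  by right; rewrite !pairingDl !pairingDr !seps2 !pairing_seps pq eq_sym pq.
move=> a /norm na; apply/negP => /norm.
by rewrite pairingZl pairingZr; lia.
Qed.

Lemma C_crefl_root : {in C_roots &, forall a b, exists2 c, c \in C_roots &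
  C_coroot b - pairing a (C_coroot b) *: C_coroot a = C_coroot c}.
Proof.
move=> a b aR bR; exists (C_refl a b); first exact: C_refl_root.
by rewrite C_crefl // C_refl_coroot.
Qed.

Definition C_datum : root_datum n :=
  RootDatum C_coroot_inj C_pairing2 C_refl_root C_crefl_root C_reduced.

Lemma C_simply_connected : simply_connected C_datum.
Proof.
move=> y; pose f (i : 'I_n) : X := 2 *: seps (i, false).
have fE i : C_coroot (f i) = delta_mx 0 i.
  by rewrite C_coroot_long /seps expr0 scale1r.
exists (fun a => \sum_i (a == f i)%:R * y 0 i).
rewrite [LHS]row_sum_delta /=.
under [RHS]eq_bigr => a _ do rewrite scaler_suml.
rewrite exchange_big; apply: eq_bigr => i _ /=.
rewrite (big_fsetD1 (f i)) ?long_root //= eqxx mul1r fE big_seq big1 ?addr0 //.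
by move=> a; rewrite !inE => /andP[/negPf-> _]; rewrite mul0r scale0r.
Qed.

(* Numbered from 1, in the usual order along the Dynkin diagram:
   eps_1 - eps_2, ..., eps_(n-1) - eps_n, 2 eps_n *)
Definition C_simple (k : nat) : X :=
  let eps k : X := \row_(j < n) (j.+1 == k)%:R in
  if k == n then 2 *: eps n else eps k - eps k.+1.

End TypeC.

Definition C4_root (c1 c2 c3 c4 : int) : 'rV[int]_4 :=
  c1 *: C_simple 4 1 + c2 *: C_simple 4 2 + c3 *: C_simple 4 3
  + c4 *: C_simple 4 4.

(* Main.v *)
Require Import Defs.
From HB Require Import structures.
From mathcomp Require Import all_boot all_order all_algebra.
From mathcomp Require Import finmap zify ring.
Set Implicit Arguments.
Unset Strict Implicit.
Unset Printing Implicit Defensive.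
Import Order.TTheory GRing.Theory Num.Theory.
Local Open Scope ring_scope.

(* N_(a,b) is odd when a + b is a short root and even when it is long, so the
   bracket of L over F_2 is determined, and the 2-map is determined by its
   values on the Chevalley basis; both are computed in coordinates.  An
   endomorphism over F_2 is diagonalizable iff it is idempotent, so a split
   toral H' containing H consists of elements x that commute with y_2 and y_3
   and satisfy (ad x)^2 = ad x.  As (ad y_k)^2 = ad y_k, the centralizer of y_2
   and y_3 is the image of (1 + ad y_3)(1 + ad y_2); it has 2^12 elements, and
   those with (ad x)^2 = ad x are the 8 elements of H. *)

(** * Bilinearity of the bracket and its values on the Chevalley basis *)

Section BracketTheory.
Variables (F : comNzRingType) (n : nat) (R : root_datum n).
Variable N : 'rV[int]_n -> 'rV[int]_n -> int.
Local Notation L := ('rV[F]_n * {ffun rd_roots R -> F^o})%type.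
Local Notation br := (@chevalley_bracket F n R N).

Lemma pairingF_linear a k (y z : 'rV[F]_n) :
  pairingF a (k *: y + z) = k * pairingF a y + pairingF a z.
Proof.
rewrite /pairingF mulr_sumr -big_split; apply: eq_bigr => i _ /=.
by rewrite !mxE; ring.
Qed.

Lemma pairingF0 a : pairingF a (0 : 'rV[F]_n) = 0.
Proof. by rewrite /pairingF big1 // => i _; rewrite mxE mulr0. Qed.

Lemma chevalley_bracket_linearl k (u u' v : L) :
  br (k *: u + u') v = k *: br u v + br u' v.
Proof.
rewrite /chevalley_bracket scalerDr addrACA !scaler_sumr.
congr (_ + _); rewrite -big_split; apply: eq_bigr => a _ /=.
  rewrite scalerA -scalerDl !ffunE pairingF_linear; congr (_ *: _).
  (* Scaling in the regular module is multiplication; it has to be displayed as such for [ring]. *)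
  by rewrite -[k *: _]/(k * _); ring.
rewrite scaler_sumr -big_split; apply: eq_bigr => b _.
rewrite /= scalerA -scalerDl !ffunE; congr (_ *: _).
by rewrite -[k *: _]/(k * _); ring.
Qed.

Lemma chevalley_bracket_linearr k (u v v' : L) :
  br u (k *: v + v') = k *: br u v + br u v'.
Proof.
rewrite /chevalley_bracket scalerDr addrACA !scaler_sumr.
congr (_ + _); rewrite -big_split; apply: eq_bigr => a _ /=.
  rewrite scalerA -scalerDl !ffunE pairingF_linear; congr (_ *: _).
  by rewrite -[k *: _]/(k * _); ring.
rewrite scaler_sumr -big_split; apply: eq_bigr => b _.
rewrite /= scalerA -scalerDl !ffunE; congr (_ *: _).
by rewrite -[k *: _]/(k * _); ring.
Qed.

Lemma chevalley_bracketDl (u u' v : L) : br (u + u') v = br u v + br u' v.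
Proof. by rewrite -{1}[u]scale1r chevalley_bracket_linearl scale1r. Qed.

Lemma chevalley_bracketDr (u v v' : L) : br u (v + v') = br u v + br u v'.
Proof. by rewrite -{1}[v]scale1r chevalley_bracket_linearr scale1r. Qed.

Lemma chevalley_bracket0l (v : L) : br 0 v = 0.
Proof. by apply: (addrI (br 0 v)); rewrite -chevalley_bracketDl !addr0. Qed.

Lemma chevalley_bracket0r (u : L) : br u 0 = 0.
Proof. by apply: (addrI (br u 0)); rewrite -chevalley_bracketDr !addr0. Qed.

(** Makes ad u a linear map, as [linear_sum], [diagonalizable_F2] and [decode_linear_ext]
    require. *)
HB.instance Definition _ (u : L) :=
  GRing.isLinear.Build F L L *:%R (br u)
    (fun k v v' => chevalley_bracket_linearr k u v v').

Lemma chevalley_bracketXX a b : a \in rd_roots R -> b \in rd_roots R ->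
  br (Xroot F R a) (Xroot F R b) = root_bracket F R N a b.
Proof.
move=> aR bR; rewrite /chevalley_bracket big1 => [|c _]; last first.
  by rewrite pairingF0 !mulr0 subrr scale0r.
rewrite add0r (bigD1 (Sub a aR)) //= [X in _ + X]big1 => [|c /negPf ca].
  rewrite (bigD1 (Sub b bR)) //= big1 ?addr0 => [|c /negPf cb].
    by rewrite !ffunE /= !eqxx mulr1 scale1r ?addr0.
  by rewrite !ffunE -val_eqE /= in cb *; rewrite cb mulr0 scale0r.
by rewrite big1 // => d _; rewrite !ffunE -val_eqE /= in ca *;
  rewrite ca mul0r scale0r.
Qed.

Lemma chevalley_bracketXY a (y : 'rV[F]_n) : a \in rd_roots R ->
  br (Xroot F R a) (y, 0) = pairingF a y *: Xroot F R a.
Proof.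
move=> aR; rewrite /chevalley_bracket [X in _ + X]big1 => [|c _]; last first.
  by rewrite big1 // => d _; rewrite [X in _ * X]ffunE mulr0 scale0r.
rewrite addr0 (bigD1 (Sub a aR)) //= big1 ?addr0 => [|c /negPf ca].
  by rewrite !ffunE eqxx mul1r mul0r subr0.
by rewrite !ffunE -val_eqE /= in ca *; rewrite ca !mul0r subrr scale0r.
Qed.

Lemma chevalley_bracketYX a (y : 'rV[F]_n) : a \in rd_roots R ->
  br (y, 0) (Xroot F R a) = - pairingF a y *: Xroot F R a.
Proof.
move=> aR; rewrite /chevalley_bracket [X in _ + X]big1 => [|c _]; last first.
  by rewrite big1 // => d _; rewrite [X in X * _]ffunE mul0r scale0r.
rewrite addr0 (bigD1 (Sub a aR)) //= big1 ?addr0 => [|c /negPf ca].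
  by rewrite !ffunE eqxx mul1r mul0r add0r.
by rewrite !ffunE -val_eqE /= in ca *; rewrite ca !mul0r subrr scale0r.
Qed.

Lemma chevalley_bracketYY (y z : 'rV[F]_n) : br (y, 0) (z, 0) = 0.
Proof.
rewrite /chevalley_bracket !big1 ?addr0 // => a _.
  by rewrite big1 // => b _; rewrite !ffunE mul0r scale0r.
by rewrite !ffunE !mul0r subrr scale0r.
Qed.

Lemma Xroot_notin a : a \notin rd_roots R -> Xroot F R a = 0.
Proof.
move=> aR; congr (_, _); apply/ffunP => b; rewrite !ffunE.
by case: eqP => // ba; rewrite -ba (valP b) in aR.
Qed.

End BracketTheory.

(** * Arithmetic and diagonalizable endomorphisms over F_2 *)

Lemma F2_cases (k : 'F_2) : k = 0 \/ k = 1.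
Proof. by case: k => [[|[|]]] // i; [left|right]; apply: val_inj. Qed.

Lemma F2_oppr (k : 'F_2) : - k = k.
Proof. by case: (F2_cases k) => ->; apply: val_inj. Qed.

Lemma F2_natr m : m%:R = (odd m)%:R :> 'F_2.
Proof.
rewrite -[m in LHS]odd_double_half natrD -muln2 natrM.
by rewrite (_ : 2%:R = 0 :> 'F_2) ?mulr0 ?addr0 //; apply: val_inj.
Qed.

Lemma F2_intr (x : int) : x%:~R = (odd `|x|%N)%:R :> 'F_2.
Proof.
rewrite -F2_natr; case: x => m //.
by rewrite NegzE mulrNz F2_oppr abszN.
Qed.

(** The only possible eigenvalues are 0 and 1, and both satisfy k^2 = k. Conversely, an idempotent f
    splits V as the direct sum of the images of f and 1 - f, on which it acts as 1 and 0; bases of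
    the two images together form an eigenbasis. *)
Lemma diagonalizable_F2 (V : vectType 'F_2) (f : {linear V -> V}) :
  diagonalizable_endo f <-> forall x, f (f x) = f x.
Proof.
split=> [[b bV bE] x|fK].
  rewrite (coord_basis (X := in_tuple b) bV (memvf x)) !linear_sum.
  apply: eq_bigr => i _; rewrite !linearZ /=; congr (_ *: _).
  have [k e] := bE _ (mem_nth 0 (ltn_ord i)).
  by rewrite !e linearZ /= e scalerA; case: (F2_cases k) => ->;
    rewrite ?mul0r ?mul1r.
pose g := linfun f.
pose h : 'End(V) := (\1 - g)%VF.
have gE x : g x = f x by rewrite lfunE.
have hE x : h x = x - f x by rewrite add_lfunE opp_lfunE id_lfunE gE.
have dUW : (limg g :&: limg h = 0)%VS.
  apply/eqP; rewrite -subv0; apply/subvP => x.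
  rewrite memv_cap memv0 => /andP[/memv_imgP[u _ xu] /memv_imgP[w _ xw]].
  have xK : f x = x by rewrite xu gE fK.
  by rewrite -xK xw hE linearB /= fK subrr.
have sUW : (limg g + limg h = fullv)%VS.
  apply/eqP; rewrite eqEsubv subvf; apply/subvP => x _.
  rewrite -[x](subrK (f x)) addrC -hE -gE.
  by rewrite memv_add ?memv_img ?memvf.
exists (vbasis (limg g) ++ vbasis (limg h)).
  have := cat_basis (introT directv_addP dUW) (vbasisP _) (vbasisP _).
  by rewrite sUW.
move=> v; rewrite mem_cat => /orP[] /vbasis_mem /memv_imgP[u _ ->].
  by exists 1; rewrite gE fK scale1r.
by exists 0; rewrite hE linearB /= fK subrr scale0r.
Qed.

(** * The roots of C_4 as integer sequences, in the coordinates eps_1, ..., eps_4 *)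

Definition vec4 (s : seq int) : 'rV[int]_4 := \row_i s`_i.

Definition seq4 (a : 'rV[int]_4) : seq int := mkseq (fun i => a 0 (inord i)) 4.

Lemma seq4K : cancel seq4 vec4.
Proof.
by move=> a; apply/rowP => i; rewrite mxE nth_mkseq // inord_val.
Qed.

Lemma vec4K s : size s = 4%N -> seq4 (vec4 s) = s.
Proof.
move=> s4; apply: (@eq_from_nth _ 0) => [|i]; rewrite size_mkseq ?s4 // => i4.
by rewrite nth_mkseq // mxE inordK.
Qed.

(** Missing entries read as 0, so that [[::]] serves as the zero vector: [vlin (-1) [::] t] is -t,
    always of length 4. *)
Definition vlin (k : int) (s t : seq int) : seq int :=
  mkseq (fun i => s`_i + k * t`_i) 4.

Lemma vec4_lin k s t : vec4 (vlin k s t) = vec4 s + k *: vec4 t.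
Proof. by apply/rowP => i; rewrite !mxE nth_mkseq. Qed.

Definition sunit (k : nat) (b : bool) : seq int :=
  mkseq (fun i => if i == k then (-1) ^+ b else 0) 4.

Lemma vec4_sunit (p : 'I_4 * bool) : vec4 (sunit p.1 p.2) = seps p.
Proof.
apply/rowP => i; rewrite !mxE nth_mkseq // eqxx andTb -val_eqE /=.
by case: eqP; rewrite ?mulr1 ?mulr0.
Qed.

Definition sunits : seq (seq int) :=
  [seq sunit k b | k <- iota 0 4, b <- [:: false; true]].

Lemma sunitsP s :
  reflect (exists p : 'I_4 * bool, s = sunit p.1 p.2) (s \in sunits).
Proof.
apply: (iffP idP) => [/allpairsP[[k b] [k4 _ ->]]|[[k b] ->]].
  by rewrite mem_iota in k4; exists (Ordinal k4, b).
by apply/allpairsP; exists (val k, b); rewrite mem_iota ltn_ord; case: b.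
Qed.

(** The order of this list fixes the numbering of the root coordinates of L. *)
Definition C4_roots : seq (seq int) :=
  [seq s <- undup [seq vlin 1 s t | s <- sunits, t <- sunits] | s != nseq 4 0].

Lemma size_C4_roots : size C4_roots = 32%N.
Proof. by vm_compute. Qed.

Lemma uniq_C4_roots : uniq C4_roots.
Proof. by vm_compute. Qed.

Lemma size_mem_C4_roots s : s \in C4_roots -> size s = 4%N.
Proof.
have /allP h : all (fun s => size s == 4%N) C4_roots by vm_compute.
by move/h/eqP.
Qed.

(** Both sides describe the nonzero sums of two vectors +- eps_i. On sequences of length 4 the map
    [vec4] is injective, so nothing is lost in the passage. *)
Lemma mem_C4_roots s : size s = 4%N ->
  (vec4 s \in C_roots 4) = (s \in C4_roots).
Proof.
move=> s4.
have vec4_eq0 t : size t = 4%N -> (vec4 t == 0) = (t == nseq 4 0).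
  move=> t4; rewrite -(inj_eq (can_inj seq4K)) vec4K //.
  congr (_ == _); apply: (@eq_from_nth _ 0); rewrite size_mkseq // => i i4.
  by rewrite nth_mkseq // mxE nth_nseq i4.
rewrite mem_filter mem_undup; apply/C_rootsP/andP.
  case=> s0 [p [q e]]; split; first by rewrite -vec4_eq0.
  apply/allpairsP; exists (sunit p.1 p.2, sunit q.1 q.2).
  split; [by apply/sunitsP; exists p|by apply/sunitsP; exists q|].
  rewrite -[LHS](vec4K s4) e -!vec4_sunit -[vec4 (sunit q.1 _)]scale1r.
  by rewrite -vec4_lin vec4K.
case=> s0 /allpairsP[[u v] /= [/sunitsP[p ->] /sunitsP[q ->] e]]; split.
  by rewrite vec4_eq0.
by exists p, q; rewrite e vec4_lin scale1r !vec4_sunit.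
Qed.

(** * Elements of L as bit vectors of length 36 *)

Fixpoint bxor (s t : seq bool) : seq bool :=
  match s, t with
  | [::], _ => t
  | _, [::] => s
  | b :: s', c :: t' => b (+) c :: bxor s' t'
  end.

(** Holds for all lengths, since [bxor] and [nth false] both pad with [false]. *)
Lemma nth_bxor s t i : nth false (bxor s t) i = nth false s i (+) nth false t i.
Proof.
elim: s t i => [|b s IHs] [|c t] [|i] //=; rewrite ?nth_nil ?addbF //.
Qed.

Definition bunit (i : nat) : seq bool := mkseq (fun j => j == i) 36.

Arguments bxor : simpl never.
Arguments bunit : simpl never.

Definition bzero : seq bool := nseq 36 false.

(** The F_2-linear combination of [vs] with coefficients [s]; missing coefficients count as 0. *)
Definition bcomb (s : seq bool) (vs : seq (seq bool)) : seq bool :=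
  foldr (fun bv acc => if bv.1 : bool then bxor bv.2 acc else acc) bzero
    (zip s vs).

Notation L4 := (chevalley 'F_2 4 (C_datum 4)).

(* Bits 0-31 are the coefficients of the root vectors, in the order of
   [C4_roots], and bits 32-35 those of the standard basis of Y (x) F_2. *)
Definition decode (s : seq bool) : L4 :=
  (\row_i (nth false s (32 + i)%N)%:R,
   [ffun a => (nth false s (index (seq4 (val a)) C4_roots))%:R]).

Lemma decode_index (a : rd_roots (C_datum 4)) :
  (index (seq4 (val a)) C4_roots < 32)%N.
Proof.
rewrite -size_C4_roots index_mem -mem_C4_roots ?size_mkseq // seq4K.
exact: (valP a).
Qed.

Lemma decode_eq s t :
    (forall i, (i < 36)%N -> nth false s i = nth false t i) ->
  decode s = decode t.
Proof.
move=> st; congr (_, _).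
  by apply/rowP => i; rewrite !mxE st // (ltn_add2l 32 _ 4).
by apply/ffunP => a; rewrite !ffunE st //; exact: leq_trans (decode_index a) _.
Qed.

Lemma decodeD s t : decode (bxor s t) = decode s + decode t.
Proof.
have F2D (b c : bool) : (b (+) c)%:R = b%:R + c%:R :> 'F_2.
  by case: b c => [] []; apply: val_inj.
congr (_, _); first by apply/rowP => i; rewrite !mxE nth_bxor F2D.
by apply/ffunP => a; rewrite !ffunE nth_bxor F2D.
Qed.

Lemma decode0 : decode bzero = 0.
Proof.
congr (_, _); first by apply/rowP => i; rewrite !mxE nth_nseq if_same.
by apply/ffunP => a; rewrite !ffunE nth_nseq if_same.
Qed.

Lemma decode_comb s vs : decode (bcomb s vs) =
  \sum_(i < size vs) decode (nth [::] vs i) *+ nth false s i.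
Proof.
rewrite /bcomb; elim: vs s => [|v vs IHvs] [|b s]; rewrite /= ?decode0.
- by rewrite big_ord0.
- by rewrite big_ord0.
- by rewrite big1 // => i _; rewrite nth_nil mulr0n.
by rewrite big_ord_recl /= -IHvs; case: b; rewrite ?decodeD ?add0r.
Qed.

Lemma decode_sum s : decode s = \sum_(i < 36) decode (bunit i) *+ nth false s i.
Proof.
(* [decode] reads only the first 36 bits, and on these s agrees with the combination of unit vectors
   that has the bits of s as coefficients. *)
transitivity (decode (bcomb s (mkseq bunit 36))); last first.
  by rewrite decode_comb; apply: eq_bigr => i _; rewrite nth_mkseq.
apply: decode_eq => i i36.
have bcomb_nth (t : seq bool) vs : nth false (bcomb t vs) i =
    \big[addb/false]_(j < size vs)
      (nth false t j && nth false (nth [::] vs j) i).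
  rewrite /bcomb; elim: vs t => [|v vs IHvs] [|b t];
    rewrite /= ?nth_nseq ?if_same ?big_ord0 //.
    by rewrite big1 // => j _; rewrite nth_nil.
  by rewrite big_ord_recl /= -IHvs; case: b; rewrite ?nth_bxor.
rewrite bcomb_nth (bigD1 (Ordinal i36)) //= big1 => [|j ji].
  by rewrite addbF nth_mkseq // nth_mkseq // eqxx andbT.
rewrite nth_mkseq // nth_mkseq // eq_sym.
by rewrite (_ : (val j == i) = false) ?andbF //; apply: contraNF ji.
Qed.

Lemma decode_surj (u : L4) : exists s, u = decode s.
Proof.
(* The bits record which coordinates of u are nonzero. For i < 32 the i-th listed vector is a root,
   so the default [false] of [oapp] is never reached. *)
exists (mkseq (fun i => if (i < 32)%N then
    oapp (fun a : rd_roots (C_datum 4) => u.2 a != 0) false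
      (insub (vec4 (nth [::] C4_roots i)))
  else u.1 0 (inord (i - 32)) != 0) 36).
have F2E (k : 'F_2) : k = (k != 0)%:R.
  by case: (F2_cases k) => ->; apply: val_inj.
rewrite [LHS]surjective_pairing; congr (_, _).
  apply/rowP => i; rewrite mxE nth_mkseq ?ltn_add2l //=.
  by rewrite addKn inord_val -F2E.
apply/ffunP => a; rewrite ffunE nth_mkseq; last first.
  exact: leq_trans (decode_index a) _.
rewrite decode_index nth_index -?mem_C4_roots ?size_mkseq ?seq4K ?(valP a) //.
by rewrite valK /= -F2E.
Qed.

Definition bvanish (s : seq bool) : bool := all negb (take 36 s).

(** The listed roots are distinct, so each of the first 36 bits is a coordinate of its own.
    Equations in L thereby become bit tests. *)
Lemma decode_eq0 s : (decode s == 0) = bvanish s.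
Proof.
apply/eqP/(all_nthP false) => [s0 i|s0]; last first.
  rewrite -decode0; apply: decode_eq => i i36; rewrite nth_nseq i36.
  have [is_|si] := ltnP i (size (take 36 s)).
    by have := s0 i is_; rewrite nth_take // => /negPf.
  by rewrite nth_default //; move: si; rewrite size_take; case: ifP; lia.
rewrite size_take => i_lt.
have i36 : (i < 36)%N by move: i_lt; case: ifP; lia.
rewrite nth_take //; have [i32|i32] := ltnP i 32.
  have iL : nth [::] C4_roots i \in C4_roots by rewrite mem_nth ?size_C4_roots.
  have i4 := size_mem_C4_roots iL.
  have iR : vec4 (nth [::] C4_roots i) \in rd_roots (C_datum 4).
    by rewrite mem_C4_roots.
  have := congr1 (fun u : L4 => u.2 [` iR]%fset) s0.
  rewrite !ffunE vec4K // index_uniq ?size_C4_roots ?uniq_C4_roots //.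
  by case: nth.
have i4 : (i - 32 < 4)%N by lia.
have := congr1 (fun u : L4 => u.1 0 (Ordinal i4)) s0.
by rewrite !mxE /= subnKC //; case: nth.
Qed.

Lemma bvanish_bxor s t : bvanish (bxor s t) = (decode s == decode t).
Proof. by rewrite -decode_eq0 decodeD addr_eq0 -scaleN1r F2_oppr scale1r. Qed.

(** * Coroots, root vectors and the structure constants modulo 2 *)

Lemma vec4_nil : vec4 [::] = 0.
Proof. by apply/rowP => i; rewrite !mxE nth_nil. Qed.

Lemma vec4_eq s t : size s = 4%N -> size t = 4%N ->
  (vec4 s == vec4 t) = (s == t).
Proof.
by move=> s4 t4; apply/eqP/eqP => [|->//] /(congr1 seq4); rewrite !vec4K.
Qed.

Definition sqnorm (s : seq int) : int := foldr (fun x acc => x * x + acc) 0 s.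

Definition coroot (s : seq int) : seq int :=
  mkseq (fun i => divz (2 * s`_i) (sqnorm s)) 4.

Lemma vec4_coroot s : size s = 4%N -> vec4 (coroot s) = C_coroot (vec4 s).
Proof.
move=> s4; apply/rowP => i; rewrite !mxE nth_mkseq //; congr (divz _ _).
rewrite /pairing !big_ord_recl big_ord0 !mxE.
by case: s s4 => [|a [|b [|c [|d [|]]]]].
Qed.

Definition bX (s : seq int) : seq bool :=
  if s \in C4_roots then bunit (index s C4_roots) else bzero.

Definition bY (s : seq int) : seq bool :=
  nseq 32 false ++ mkseq (fun i => odd (absz s`_i)) 4.

Lemma decode_bX s : size s = 4%N ->
  decode (bX s) = Xroot 'F_2 (C_datum 4) (vec4 s).
Proof.
move=> s4; rewrite /bX; case: ifP => sR; last first.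
  by rewrite decode0 Xroot_notin //= mem_C4_roots ?sR.
have i32 : (index s C4_roots < 32)%N by rewrite -size_C4_roots index_mem.
congr (_, _).
  apply/rowP => i; rewrite !mxE nth_mkseq ?(ltn_add2l 32 _ 4) //.
  by rewrite (_ : (_ == _) = false) //; apply/eqP; lia.
apply/ffunP => a; rewrite !ffunE nth_mkseq; last first.
  exact: leq_trans (decode_index a) _.
rewrite -[val a in RHS]seq4K vec4_eq // ?size_mkseq //; congr (_%:R).
apply: congr1; apply/eqP/eqP => [|->//].
move=> /(congr1 (nth [::] C4_roots)); rewrite !nth_index //.
by rewrite -index_mem size_C4_roots decode_index.
Qed.

Lemma decode_bY s : decode (bY s) = Ytensor 'F_2 (C_datum 4) (vec4 s).
Proof.
congr (_, _).
  apply/rowP => i; rewrite !mxE nth_cat size_nseq ltnNge leq_addr /= addKn.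
  by rewrite nth_mkseq // F2_intr.
apply/ffunP => a; rewrite !ffunE nth_cat size_nseq decode_index nth_nseq.
by rewrite if_same.
Qed.

(** Short roots have square norm 2 and long ones 4, so the second test keeps exactly the sums that
    are short roots, where N is odd. *)
Definition root_bracketb (s t : seq int) : seq bool :=
  if s == vlin (-1) [::] t then bY (coroot t)
  else if sqnorm (vlin 1 s t) == 2 then bX (vlin 1 s t) else bzero.

(* p is p_(s,t): the t-string through s stops at s - p t. *)
Lemma root_string_parity :
  all (fun s => all (fun t => all (fun p : nat =>
    [&& s != vlin (-1) [::] t, vlin 1 s t \in C4_roots,
        vlin (- p%:Z) s t \in C4_roots & vlin (- p.+1%:Z) s t \notin C4_roots]
    ==> (odd p.+1 == (sqnorm (vlin 1 s t) == 2)))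
   (iota 0 5)) C4_roots) C4_roots.
Proof. by vm_compute. Qed.

(** Some coordinate of t is nonzero, while those of s and s - p t are at most 2 in absolute value.
    This makes the range [iota 0 5] of [root_string_parity] exhaustive. *)
Lemma root_string_bound s t (p : int) : s \in C4_roots -> t \in C4_roots ->
  vlin (- p) s t \in C4_roots -> p <= 4.
Proof.
move=> sR tR uR.
have /allP bound :
    all (fun s => all (fun i => `|s`_i| <= 2) (iota 0 4)) C4_roots.
  by vm_compute.
have /allP nz : all (fun s => has (fun i => s`_i != 0) (iota 0 4)) C4_roots.
  by vm_compute.
have [i i4 ti] := hasP (nz _ tR).
have := allP (bound _ uR) _ i4; have := allP (bound _ sR) _ i4.
rewrite nth_mkseq; last by rewrite mem_iota in i4.
by move: (s`_i) (t`_i) ti => x y; nia.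
Qed.

Section Structure.
Variable N : 'rV[int]_4 -> 'rV[int]_4 -> int.
Hypothesis hN : chevalley_constants (C_datum 4) N.
Local Notation br := (@chevalley_bracket 'F_2 4 (C_datum 4) N).

Lemma structure_constant_parity s t :
    s \in C4_roots -> t \in C4_roots -> s != vlin (-1) [::] t ->
  vlin 1 s t \in C4_roots ->
  (N (vec4 s) (vec4 t))%:~R = (sqnorm (vlin 1 s t) == 2)%:R :> 'F_2.
Proof.
move=> sR tR st stR.
have [s4 t4] := (size_mem_C4_roots sR, size_mem_C4_roots tR).
have memR k : (vec4 s + k *: vec4 t \in rd_roots (C_datum 4)) =
    (vlin k s t \in C4_roots).
  by rewrite -vec4_lin mem_C4_roots // size_mkseq.
have [||||| p [p1 pmax NE]] := hN.1 (vec4 s) (vec4 t).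
- by rewrite mem_C4_roots.
- by rewrite mem_C4_roots.
(* If s = t, then s + t = 2 t is not a root, as the root system is reduced. *)
- apply: contraTneq stR => stE; rewrite -memR stE scale1r -mulr2n -scaler_nat.
  by apply: C_reduced; rewrite mem_C4_roots.
- by rewrite -[- vec4 t]add0r -scaleN1r -vec4_nil -vec4_lin vec4_eq ?size_mkseq.
- by rewrite -[vec4 t]scale1r memR.
have memRN q : (vec4 s - q *: vec4 t \in rd_roots (C_datum 4)) =
    (vlin (- q) s t \in C4_roots) by rewrite -scaleNr memR.
rewrite memRN in p1.
(* The root s itself, at q = 0, lies on the string. *)
have p0 : 0 <= p by apply: pmax; rewrite scale0r subr0 /= mem_C4_roots.
have p4 := root_string_bound sR tR p1.
have p2 : vlin (- (p + 1)) s t \notin C4_roots.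
  by rewrite -memRN; apply/negP => /pmax; lia.
case: p p0 p4 p1 p2 NE {pmax} => // p _ p4 p1 p2 NE.
have /allP/(_ s sR)/allP/(_ t tR)/allP/(_ p) := root_string_parity.
rewrite mem_iota st stR p1 -[p.+1]addn1 PoszD p2 addn1 => /(_ p4)/eqP <-.
(* The undetermined sign of N disappears in the absolute value. *)
by rewrite F2_intr; congr ((odd _)%:R); case: NE => ->; lia.
Qed.

Lemma decode_root_bracket s t : s \in C4_roots -> t \in C4_roots ->
  root_bracket 'F_2 (C_datum 4) N (vec4 s) (vec4 t) =
  decode (root_bracketb s t).
Proof.
move=> sR tR; have [s4 t4] := (size_mem_C4_roots sR, size_mem_C4_roots tR).
rewrite /root_bracket /root_bracketb.
rewrite -[- vec4 t]add0r -scaleN1r -vec4_nil -vec4_lin vec4_eq ?size_mkseq //.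
case: ifP => [_|/negbT st]; first by rewrite decode_bY vec4_coroot.
rewrite -[X in Xroot _ _ (_ + X)]scale1r -vec4_lin -decode_bX ?size_mkseq //.
have [stR|/negPf stR] := boolP (vlin 1 s t \in C4_roots); last first.
  by rewrite /bX stR decode0 scaler0 if_same decode0.
rewrite structure_constant_parity //.
by case: ifP; rewrite ?scale1r // scale0r decode0.
Qed.

(** * The bracket in coordinates *)

Definition basis_bracket (i j : nat) : seq bool :=
  let r k := nth [::] C4_roots k in
  match (i < 32)%N, (j < 32)%N with
  | true, true => root_bracketb (r i) (r j)
  | true, false => if odd (absz (r i)`_(j - 32)) then bunit i else bzero
  | false, true => if odd (absz (r j)`_(i - 32)) then bunit j else bzero
  | false, false => bzero
  end.

Lemma decode_root i : (i < 32)%N ->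
  decode (bunit i) = Xroot 'F_2 (C_datum 4) (vec4 (nth [::] C4_roots i)).
Proof.
rewrite -size_C4_roots => i32; have iR := mem_nth [::] i32.
rewrite -decode_bX ?(size_mem_C4_roots iR) // /bX iR.
by rewrite index_uniq ?uniq_C4_roots.
Qed.

Lemma decode_torus (i : 'I_4) : decode (bunit (32 + i)%N) = (delta_mx 0 i, 0).
Proof.
congr (_, _).
  apply/rowP => j; rewrite !mxE nth_mkseq ?(ltn_add2l 32 _ 4) //.
apply/ffunP => a; rewrite !ffunE nth_mkseq; last first.
  exact: leq_trans (decode_index a) _.
rewrite ltn_eqF //; exact: leq_trans (decode_index a) (leq_addr _ _).
Qed.

(** The basis of Y is dual to the eps_i, so pairing with it picks a coordinate of the root, here
    modulo 2. *)
Lemma pairingF_delta s (i : 'I_4) :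
  pairingF (vec4 s) (delta_mx 0 i : 'rV['F_2]_4) = (odd (absz s`_i))%:R.
Proof.
rewrite /pairingF (bigD1 i) //= big1 => [|j /negPf ji].
  by rewrite !mxE !eqxx mulr1 addr0 F2_intr.
by rewrite !mxE ji andbF mulr0.
Qed.

Lemma decode_basis_bracket i j : (i < 36)%N -> (j < 36)%N ->
  br (decode (bunit i)) (decode (bunit j)) = decode (basis_bracket i j).
Proof.
have rootP k : (k < 32)%N -> nth [::] C4_roots k \in C4_roots.
  by move=> k32; rewrite mem_nth ?size_C4_roots.
have rootP' k : (k < 32)%N ->
    vec4 (nth [::] C4_roots k) \in rd_roots (C_datum 4).
  by move=> /rootP kR; rewrite mem_C4_roots ?(size_mem_C4_roots kR).
have torusE k : (k < 36)%N -> (32 <= k)%N ->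
    {l : 'I_4 | decode (bunit k) = (delta_mx 0 l, 0) & l = (k - 32)%N :> nat}.
  move=> k36 k32; have l4 : (k - 32 < 4)%N by lia.
  by exists (Ordinal l4) => //; rewrite -decode_torus /= subnKC.
move=> i36 j36; rewrite /basis_bracket.
have [i32|i32] := ltnP i 32; have [j32|j32] := ltnP j 32.
- rewrite !decode_root // chevalley_bracketXX ?rootP' //.
  by rewrite decode_root_bracket ?rootP.
- have [l -> <-] := torusE j j36 j32.
  rewrite decode_root // chevalley_bracketXY ?rootP' // pairingF_delta.
  by case: odd; rewrite ?scale1r ?scale0r ?decode0 // decode_root.
- have [l -> <-] := torusE i i36 i32.
  rewrite decode_root // chevalley_bracketYX ?rootP' // pairingF_delta F2_oppr.
  by case: odd; rewrite ?scale1r ?scale0r ?decode0 // decode_root.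
have [l -> _] := torusE i i36 i32; have [m -> _] := torusE j j36 j32.
by rewrite chevalley_bracketYY decode0.
Qed.

Definition bracket_table : seq (seq (seq bool)) :=
  mkseq (fun i => mkseq (basis_bracket i) 36) 36.

Definition bracketb (s t : seq bool) : seq bool :=
  bcomb s [seq bcomb t row | row <- bracket_table].

Lemma decode_bracket s t : br (decode s) (decode t) = decode (bracketb s t).
Proof.
rewrite /bracketb decode_comb size_map size_mkseq.
rewrite {1}[decode s]decode_sum.
rewrite (big_morph (br^~ _) (fun u v => chevalley_bracketDl N u v _)
  (chevalley_bracket0l N _)).
apply: eq_bigr => i _; rewrite (nth_map [::]) ?size_mkseq // nth_mkseq //.
case: (nth false s i); rewrite ?chevalley_bracket0l //.
rewrite decode_comb size_mkseq [decode t]decode_sum linear_sum.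
apply: eq_bigr => j _ /=; rewrite nth_mkseq // -decode_basis_bracket //.
by case: (nth false t j); rewrite ?chevalley_bracket0r.
Qed.

End Structure.

(** * Spans over F_2 as explicit lists of elements *)

Definition bspan (vs : seq (seq bool)) : seq (seq bool) :=
  foldr (fun v l => if v \in l then l else l ++ [seq bxor v w | w <- l])
    [:: bzero] vs.

(** The line through v is {0, v}, so adjoining v doubles the list. A v already listed is skipped,
    which keeps the list short for redundant generators. *)
Lemma mem_decode_span vs (x : L4) :
  x \in <<map decode vs>>%VS <-> exists2 c, c \in bspan vs & x = decode c.
Proof.
elim: vs x => [|v vs IHvs] x.
  rewrite span_nil memv0; split=> [/eqP ->|[c]].
    by exists bzero; rewrite ?mem_head ?decode0.
  by rewrite mem_seq1 => /eqP -> ->; rewrite decode0.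
rewrite /= span_cons; case: ifP => [vvs|_].
  rewrite (addv_idPr _) //; apply/subvP => _ /vlineP[k ->].
  by apply/memvZ/IHvs; exists v.
split=> [/memv_addP[_ /vlineP[k ->] [u /IHvs[c cvs ->] ->]]|[c]].
  case: (F2_cases k) => ->.
    by exists c; rewrite ?mem_cat ?cvs // scale0r add0r.
  exists (bxor v c); last by rewrite decodeD scale1r.
  by rewrite mem_cat map_f ?orbT.
rewrite mem_cat => /orP[cvs ->|/mapP[w wvs ->] ->].
  by apply: (subvP (addvSr _ _)); apply/IHvs; exists c.
by rewrite decodeD memv_add ?memv_line //; apply/IHvs; exists w.
Qed.

Fixpoint freeb (vs : seq (seq bool)) : bool :=
  if vs is v :: vs'
  then all (fun w => ~~ bvanish (bxor v w)) (bspan vs') && freeb vs' else true.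

Lemma free_decode vs : freeb vs -> free (map decode vs).
Proof.
elim: vs => [|v vs IHvs] /=; first by rewrite nil_free.
case/andP=> /allP nv /IHvs vs_free; rewrite free_cons vs_free andbT.
by apply/negP => /mem_decode_span[w /nv]; rewrite bvanish_bxor => /eqP.
Qed.

Section Subalgebra.
Variable N : 'rV[int]_4 -> 'rV[int]_4 -> int.
Hypothesis hN : chevalley_constants (C_datum 4) N.
Local Notation br := (@chevalley_bracket 'F_2 4 (C_datum 4) N).

(** * The 2-map in coordinates *)

Section PMap.
Variable pm : L4 -> L4.
Hypothesis hpm : two_map br pm.
Hypothesis hpmX : forall a, a \in rd_roots (C_datum 4) ->
  pm (Xroot 'F_2 (C_datum 4) a) = 0.
Hypothesis hpmY : forall a, a \in rd_roots (C_datum 4) ->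
  pm (Ytensor 'F_2 (C_datum 4) (rd_coroot (C_datum 4) a))
  = Ytensor 'F_2 (C_datum 4) (rd_coroot (C_datum 4) a).

(* The sum x of the basis vectors indexed by l, and its image under the 2-map,
   computed by (b + x)^[2] = b^[2] + x^[2] + [b, x]. *)
Definition pmap_pair (l : seq nat) : seq bool * seq bool :=
  foldr (fun i a => (bxor (bunit i) a.1,
       bxor (bxor (if (i < 32)%N then bzero else bunit i) a.2)
         (bracketb (bunit i) a.1)))
    (bzero, bzero) l.

Definition pmapb (s : seq bool) : seq bool :=
  (pmap_pair [seq i <- iota 0 36 | nth false s i]).2.

Lemma pm_basis i : (i < 36)%N ->
  pm (decode (bunit i)) = decode (if (i < 32)%N then bzero else bunit i).
Proof.
move=> i36; case: ltnP => i32.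
  rewrite decode_root // hpmX ?decode0 //= mem_C4_roots.
    by rewrite mem_nth ?size_C4_roots.
  by rewrite (@size_mem_C4_roots (nth _ _ _)) // mem_nth ?size_C4_roots.
have i4 : (i - 32 < 4)%N by lia.
(* Each standard basis vector of Y is the coroot of a long root 2 eps_i, so it is fixed by the
   2-map. *)
have -> : decode (bunit i) = Ytensor 'F_2 (C_datum 4)
    (rd_coroot (C_datum 4) (2 *: seps (Ordinal i4, false))).
  rewrite -[i in LHS](subnKC i32) (decode_torus (Ordinal i4)) /= C_coroot_long.
  by rewrite /Ytensor /seps expr0 scale1r map_delta_mx.
by apply: hpmY; apply: long_root.
Qed.

Lemma decode_pm s : pm (decode s) = decode (pmapb s).
Proof.
have [_ pmZ pmD] := hpm.
have pm0 : pm 0 = 0 by have := pmZ 0 0; rewrite scale0r expr0n scale0r.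
(* Both components are treated in one induction, since the correction term [b, x] involves the
   partial sum x. *)
have pairP (l : seq nat) : all (gtn 36) l ->
    decode (pmap_pair l).1 = \sum_(i <- l) decode (bunit i) /\
    pm (decode (pmap_pair l).1) = decode (pmap_pair l).2.
  elim: l => [|i l IHl] /=; first by rewrite big_nil decode0.
  case/andP=> i36 /IHl[e1 e2]; rewrite big_cons; split.
    by rewrite decodeD e1.
  by rewrite decodeD pmD pm_basis // e2 !decodeD (decode_bracket hN).
have [|e1 <-] := pairP [seq i <- iota 0 36 | nth false s i].
  by apply/allP => i; rewrite mem_filter mem_iota => /and3P[].
rewrite e1 big_filter [decode s in LHS]decode_sum.
rewrite -(big_mkord xpredT (fun i => decode (bunit i) *+ nth false s i)).
by congr pm; rewrite [RHS]big_mkcond; apply: eq_bigr => i _; case: nth.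
Qed.

End PMap.

(** * Idempotent adjoint maps and the centralizer of two elements *)

Lemma decode_linear_ext (f g : {linear L4 -> L4}) :
    (forall i, (i < 36)%N -> f (decode (bunit i)) = g (decode (bunit i))) ->
  f =1 g.
Proof.
move=> fg x; have [s ->] := decode_surj x.
rewrite decode_sum !linear_sum; apply: eq_bigr => i _ /=.
by rewrite !linearMn /= fg.
Qed.

Definition idempotent_atb (c : seq bool) (i : nat) : bool :=
  let v := bracketb c (bunit i) in bvanish (bxor (bracketb c v) v).

Lemma idempotent_atP c i :
  reflect (br (decode c) (br (decode c) (decode (bunit i)))
           = br (decode c) (decode (bunit i)))
    (idempotent_atb c i).
Proof.
by rewrite !(decode_bracket hN) /idempotent_atb bvanish_bxor; apply: eqP.
Qed.

(** When ad w is idempotent, 1 + ad w = 1 - ad w is the projection onto the centralizer of w. *)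
Definition centralizing_projb (y z : seq bool) (i : nat) : seq bool :=
  let u := bxor (bunit i) (bracketb y (bunit i)) in bxor u (bracketb z u).

(* (1 + ad z)(1 + ad y) fixes the centralizer of y and z pointwise. *)
Lemma centralizer_sub_span y z x :
    br (decode y) x = 0 -> br (decode z) x = 0 ->
  x \in <<map decode (mkseq (centralizing_projb y z) 36)>>%VS.
Proof.
have [s ->] := decode_surj x => ys zs.
pose F w u := u + br (decode w) u.
have FD w : {morph F w : u v / u + v}.
  by move=> u v; rewrite /F chevalley_bracketDr addrACA.
have F0 w : F w 0 = 0 by rewrite /F chevalley_bracket0r addr0.
have FE i : F z (F y (decode (bunit i))) = decode (centralizing_projb y z i).
  by rewrite /F !(decode_bracket hN) -!decodeD (decode_bracket hN) -decodeD.
have -> : decode s = F z (F y (decode s)) by rewrite /F ys addr0 zs addr0.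
rewrite [decode s]decode_sum (big_morph (F y) (FD y) (F0 y)).
rewrite (big_morph (F z) (FD z) (F0 z)) memv_suml // => i _.
case: nth; rewrite ?F0 ?mem0v // FE memv_span // map_f //.
by apply/mapP; exists (val i); rewrite ?mem_iota ?ltn_ord.
Qed.

(** Idempotence is tested one basis vector at a time on a shrinking list, so that most candidates
    are discarded early; an x with (ad x)^2 = ad x survives every filter. *)
Lemma centralizer_sub y z (Hl : seq (seq bool)) :
  all (mem Hl) (foldl (fun l i => [seq c <- l | idempotent_atb c i])
    (bspan (mkseq (centralizing_projb y z) 36)) (iota 0 36)) ->
  forall x, br (decode y) x = 0 -> br (decode z) x = 0 ->
    (forall v, br x (br x v) = br x v) -> exists2 c, c \in Hl & x = decode c.
Proof.
move=> /allP cHl x xy xz.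
have /mem_decode_span[c cC ->] := centralizer_sub_span xy xz => cK.
exists c => //; apply: cHl; elim: (iota _ _) (bspan _) cC => //= i s IHs l cl.
by apply: IHs; rewrite mem_filter cl andbT; apply/idempotent_atP/cK.
Qed.

End Subalgebra.

(** * The elements y_1, y_2, y_3 in coordinates and the finite checks *)

Definition hb (s : seq int) : seq bool := bY (coroot s).

Definition y1b : seq bool := bxor (hb [:: 1; -1; 0; 0]) (hb [:: 0; 0; 1; -1]).

Definition y2b : seq bool :=
  bxor (bxor (hb [:: 1; -1; 0; 0]) (bX [:: 0; 1; 1; 0])) (bX [:: -1; 0; 0; 1]).

Definition y3b : seq bool :=
  foldl bxor (hb [:: 0; 1; -1; 0])
    [:: bX [:: 0; 0; 1; -1]; bX [:: 0; 0; -1; 1];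
        bX [:: 1; 1; 0; 0]; bX [:: -1; -1; 0; 0]].

Definition Hb : seq (seq bool) := bspan [:: y1b; y2b; y3b].

(** Here alpha_k = eps_k - eps_(k+1) for k < 4, and alpha_4 = 2 eps_4. *)
Lemma C4_rootE (c1 c2 c3 c4 : int) : C4_root c1 c2 c3 c4 =
  vec4 [:: c1; c2 - c1; c3 - c2; 2 * c4 - c3].
Proof.
apply/rowP => -[[|[|[|[|]]]] i4] //; rewrite !mxE /=; ring.
Qed.

(** Only y_2 and y_3 enter: y_1 = h_1 + h_3 pairs evenly with every root, hence is central. *)
Lemma centralizer_check : all (mem Hb)
  (foldl (fun l i => [seq c <- l | idempotent_atb c i])
    (bspan (mkseq (centralizing_projb y2b y3b) 36)) (iota 0 36)).
Proof. by vm_compute. Qed.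

(** Semisimplicity is tested by x^[4] = x and not by x^[2] = x, because y_3^[2] = y_3 + y_1. *)
Lemma Hb_check :
  all (fun c => [&& all (fun d => bvanish (bracketb c d)) Hb,
                    bvanish (bxor (pmapb (pmapb c)) c) &
                    all (idempotent_atb c) (iota 0 36)]) Hb.
Proof. by vm_compute. Qed.

Lemma freeb_y : freeb [:: y1b; y2b; y3b].
Proof. by vm_compute. Qed.

Theorem proposition6
    (N : 'rV[int]_4 -> 'rV[int]_4 -> int)
    (hN : chevalley_constants (C_datum 4) N)
    (pm : chevalley 'F_2 4 (C_datum 4) -> chevalley 'F_2 4 (C_datum 4))
    (hpm : two_map (chevalley_bracket N) pm)
    (hpmX : forall a : 'rV[int]_4, a \in rd_roots (C_datum 4) ->
       pm (Xroot 'F_2 (C_datum 4) a) = 0)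
    (hpmY : forall a : 'rV[int]_4, a \in rd_roots (C_datum 4) ->
       pm (Ytensor 'F_2 (C_datum 4) (rd_coroot (C_datum 4) a))
       = Ytensor 'F_2 (C_datum 4) (rd_coroot (C_datum 4) a))
    (H : {vspace chevalley 'F_2 4 (C_datum 4)}) :
  let X := Xroot 'F_2 (C_datum 4) in
  let h (i : nat) :=
    Ytensor 'F_2 (C_datum 4) (rd_coroot (C_datum 4) (C_simple 4 i)) in
  let a3 := C4_root 0 0 1 0 in
  let a8 := C4_root 1 1 1 0 in
  let a12 := C4_root 0 1 2 1 in
  let a15 := C4_root 1 2 2 1 in
  let y1 := h 1%N + h 3%N in
  let y2 := h 1%N + X a12 + X (- a8) in
  let y3 := h 2%N + X a3 + X (- a3) + X a15 + X (- a15) in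
  generated_subalgebra (chevalley_bracket N) [:: y1; y2; y3] H ->
  [/\ \dim H = 3%N,
      split_toral (chevalley_bracket N) pm H &
      ~ exists H' : {vspace chevalley 'F_2 4 (C_datum 4)},
          [/\ split_toral (chevalley_bracket N) pm H', \dim H' = 4%N &
              (H <= H')%VS]].
Proof.
move=> X h a3 a8 a12 a15 y1 y2 y3 [Hsub yH Hmin].
have C4_rootX (c1 c2 c3 c4 : int) : X (C4_root c1 c2 c3 c4) =
    decode (bX [:: c1; c2 - c1; c3 - c2; 2 * c4 - c3]).
  by rewrite decode_bX // C4_rootE.
have C4_rootXN (c1 c2 c3 c4 : int) : X (- C4_root c1 c2 c3 c4) =
    decode (bX [:: - c1; c1 - c2; c2 - c3; c3 - 2 * c4]).
  rewrite decode_bX // C4_rootE; congr (X _).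
  by apply/rowP => -[[|[|[|[|]]]] i4] //; rewrite !mxE /= ?opprB.
have hE i s : size s = 4%N -> C_simple 4 i = vec4 s -> h i = decode (hb s).
  by move=> s4 iE; rewrite /h iE /hb decode_bY vec4_coroot.
have h1 : h 1%N = decode (hb [:: 1; -1; 0; 0]).
  by apply: hE => //; apply/rowP => -[[|[|[|[|]]]] i4] //; rewrite !mxE.
have h2 : h 2%N = decode (hb [:: 0; 1; -1; 0]).
  by apply: hE => //; apply/rowP => -[[|[|[|[|]]]] i4] //; rewrite !mxE.
have h3 : h 3%N = decode (hb [:: 0; 0; 1; -1]).
  by apply: hE => //; apply/rowP => -[[|[|[|[|]]]] i4] //; rewrite !mxE.
have y1E : y1 = decode y1b by rewrite /y1 h1 h3 !decodeD.
have y2E : y2 = decode y2b by rewrite /y2 h1 C4_rootX C4_rootXN !decodeD.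
have y3E : y3 = decode y3b by rewrite /y3 h2 !C4_rootX !C4_rootXN !decodeD.
have yE : [:: y1; y2; y3] = map decode [:: y1b; y2b; y3b].
  by rewrite /= y1E y2E y3E.
rewrite yE in yH Hmin.
have spanP x : x \in <<map decode [:: y1b; y2b; y3b]>>%VS ->
    exists2 c, c \in Hb & x = decode c by move/mem_decode_span.
have Hb_ok c : c \in Hb -> [/\ forall d, d \in Hb ->
      chevalley_bracket N (decode c) (decode d) = 0,
    pm (pm (decode c)) = decode c &
    forall x, chevalley_bracket N (decode c) (chevalley_bracket N (decode c) x)
      = chevalley_bracket N (decode c) x].
  move=> /(allP Hb_check)/and3P[/allP cc cp /allP ci]; split.
  - by move=> d /cc; rewrite (decode_bracket hN) -decode_eq0 => /eqP.
  - by rewrite !(decode_pm hN hpm hpmX hpmY); apply/eqP; rewrite -bvanish_bxor.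
  - apply: (decode_linear_ext (f := chevalley_bracket N (decode c)
      \o chevalley_bracket N (decode c))) => i i36.
    by apply/idempotent_atP/ci => //; rewrite mem_iota.
(* All brackets within the linear span vanish, so the span is already a subalgebra. *)
have HE : H = <<map decode [:: y1b; y2b; y3b]>>%VS.
  apply/eqP; rewrite eqEsubv; apply/andP; split; last exact/span_subvP.
  apply: Hmin => [x y /spanP[c cH ->] /spanP[d dH ->]|y]; last exact: memv_span.
  by have [cd _ _] := Hb_ok c cH; rewrite (cd d dH) mem0v.
have HP x : x \in H -> exists2 c, c \in Hb & x = decode c.
  by rewrite HE => /spanP.
have dimH : \dim H = 3%N.
  by rewrite HE; apply/eqP; apply: free_decode freeb_y.
split=> //.
  split; last first.
    by move=> _ /HP[c cH ->]; apply/diagonalizable_F2; case: (Hb_ok c cH).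
  split.
  - exact: Hsub.
  - move=> _ _ /HP[c cH ->] /HP[d dH ->].
    by have [cd _ _] := Hb_ok c cH; apply: cd.
  (* A p-subalgebra containing x^[2] contains (x^[2])^[2] = x. *)
  move=> _ /HP[c cH ->] U [_ Upm] cU.
  by have [_ <- _] := Hb_ok c cH; apply: Upm.
case=> H' [[[_ H'comm _] H'diag] dimH' HH'].
(* An inclusion of H' in H would give 4 <= 3. *)
suff /dimvS : (H' <= H)%VS by rewrite dimH' dimH.
have y2H' : decode y2b \in H'.
  by apply/(subvP HH')/yH/map_f; rewrite inE mem_head orbT.
have y3H' : decode y3b \in H'.
  by apply/(subvP HH')/yH/map_f; apply: (mem_last y1b [:: y2b; y3b]).
apply/subvP => x xH'.
(* Commutativity of H' puts x in the centralizer of y_2 and y_3, and splitness makes ad x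
   idempotent. *)
have [c cH ->] := centralizer_sub hN centralizer_check
  (H'comm _ _ y2H' xH') (H'comm _ _ y3H' xH')
  ((diagonalizable_F2 (chevalley_bracket N x)).1 (H'diag x xH')).
by rewrite HE; apply/mem_decode_span; exists c.
Qed.
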